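(* Let $(\phi^{(k)})_{k\ge1}$ be a sequence generated by the DC algorithm (defined in the context, with data $S,r,\epsilon$), and let $\rho$ $(\ge\epsilon^2)$ be the coefficient of strong convexity of $f_1$ on $(0,\tfrac1\epsilon]^p$. Then the sequence $f(\phi^{(k)})$ is decreasing (i.e. non-increasing) and converges to a finite limit $\hat f$, and for every integer $\mathcal{K}\ge1$, $$\min_{1\le k\le\mathcal{K}}\rho\,\|\phi^{(k+1)}-\phi^{(k)}\|_2^2\le\frac{2}{\mathcal{K}}\big(f(\phi^{(1)})-\hat f\big).$$
   Context: Setting: $p\ge 1$, $1\le r\le p$, $\epsilon>0$, and $S=(s_{ij})\in\mathbb{R}^{p\times p}$ is symmetric positive semidefinite with strictly positive diagonal entries. For $\phi\in(0,\infty)^p$ put $\Phi=\mathrm{diag}(\phi_1,\dots,\phi_p)$, let $\lambda_1^*\ge\dots\ge\lambda_p^*$ be the eigenvalues of $\Phi^{1/2}S\Phi^{1/2}$, and define $f_1(\phi)=\sum_{i=1}^p(-\log\phi_i+s_{ii}\phi_i)$, $f_2(\phi)=-\sum_{i=1}^r(\log(\max\{1,\lambda_i^*\})-\max\{1,\lambda_i^*\}+1)$, $f=f_1-f_2$. Both $f_1$ and $f_2$ are convex on $(0,\infty)^p$. Let $\mathcal{C}=\{\phi\in\mathbb{R}^p:0<\phi_i\le\tfrac1\epsilon,\ i=1,\dots,p\}$. DC algorithm: start from any $\phi^{(1)}\in\mathcal{C}$; for $k\ge1$ let $\nabla_k=(\nabla_{k,1},\dots,\nabla_{k,p})$ be a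 subgradient of the convex function $f_2$ at $\phi^{(k)}$, and let $$\phi^{(k+1)}\in\arg\min_{\phi\in\mathcal{C}}\ \sum_{i=1}^p\big(-\log\phi_i+s_{ii}\phi_i-\nabla_{k,i}\phi_i\big).$$ The sequence is taken to be infinite (no stopping rule). The coefficient of strong convexity of $f_1$ on a convex set $D$ is the largest $\rho$ such that $f_1(x)\ge f_1(y)+\langle\nabla f_1(y),x-y\rangle+\frac{\rho}{2}\|x-y\|_2^2$ for all $x,y\in D$. *)

(* Defs.v *)
From HB Require Import structures.
From mathcomp Require Import all_boot all_order all_algebra.
From mathcomp Require Import all_classical all_reals all_analysis.
From mathcomp Require Import spectral complex.

Set Implicit Arguments.
Unset Strict Implicit.
Unset Printing Implicit Defensive.

Import Order.TTheory GRing.Theory Num.Theory.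
Import numFieldNormedType.Exports.

Local Open Scope classical_set_scope.
Local Open Scope ring_scope.

(* Vectors of R^p are row vectors.  The library norm `|x|
   on 'rV_p is the sup norm, hence the separate Euclidean norm below. *)

Section Euclidean.
Context {R : realType} {p : nat}.
Implicit Types (x y g : 'rV[R]_p) (D : set 'rV[R]_p) (h : 'rV[R]_p -> R).

Definition dotv x y : R := \sum_(i < p) x 0 i * y 0 i.

Definition norm2 x : R := Num.sqrt (\sum_(i < p) x 0 i ^+ 2).

Definition gradient h x : 'rV[R]_p := \row_(i < p) 'D_(delta_mx 0 i) h x.

Definition is_subgradient D h x g : Prop :=
  forall y, D y -> h x + dotv g (y - x) <= h y.

Definition is_argmin D h x : Prop := D x /\ forall y, D y -> h x <= h y.

Definition strongly_convex_with D h (rho : R) : Prop :=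
  forall x y, D x -> D y ->
    h y + dotv (gradient h y) (x - y) + rho / 2 * norm2 (x - y) ^+ 2 <= h x.

Definition is_strong_convexity_coeff D h (rho : R) : Prop :=
  strongly_convex_with D h rho /\
  forall rho', strongly_convex_with D h rho' -> rho' <= rho.

Definition orthant : set 'rV[R]_p := [set phi | forall i, 0 < phi 0 i].

End Euclidean.
Arguments orthant : clear implicits.

Section Spectrum.
Context {R : realType} {p : nat}.
Implicit Types A : 'M[R]_p.

Definition psdmx A : Prop :=
  A^T = A /\ forall v : 'rV[R]_p, 0 <= (v *m A *m v^T) 0 0.

Definition is_spectrum A (s : seq R) : Prop :=
  sorted >=%R s /\ char_poly A = \prod_(x <- s) ('X - x%:P).

(* Nonincreasing, with multiplicity.  The default value [::] is only reached
   when the characteristic polynomial does not split over R, which is excluded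
   for symmetric matrices by [eigenvalues_sym]. *)
Definition eigenvalues A : seq R := xget [::] [set s | is_spectrum A s].

End Spectrum.

Lemma eigenvalues_sym (R : realType) (p : nat) (A : 'M[R]_p) :
  A^T = A -> is_spectrum A (eigenvalues A).
Proof.
move=> A_sym; apply: (@xgetPex _ [::]).
pose toC := real_complex R; pose AC := map_mx toC A.
have AC_herm : AC \is hermsymmx.
  apply: realsym_hermsym.
    by apply/is_hermitianmxP; rewrite expr0 scale1r map_mx_id // map_trmx A_sym.
  by apply/mxOverP => i j; rewrite mxE; apply/complex_realP; exists (A i j).
have [P [d [Pu ACE d_real]]] : exists P (d : 'rV[R[i]]_p), [/\ P \in unitmx,
    AC = invmx P *m diag_mx d *m P & forall i, d 0 i = toC (complex.Re (d 0 i))].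
  exists (spectralmx AC), (spectral_diag AC); split.
  - exact: spectral_unit.
  - exact/orthomx_spectralP/hermitian_normalmx.
  - move=> i; have /mxOverP/(_ 0 i) := hermitian_spectral_diag_real AC_herm.
    by case/complex_realP => x ->.
have charE : char_poly AC = \prod_(i < p) ('X - (d 0 i)%:P).
  have Pu' : map_mx polyC P \in unitmx.
    rewrite unitmxE det_map_mx; apply: rmorph_unit; by rewrite -unitmxE.
  rewrite /char_poly /char_poly_mx ACE !map_mxM.
  have -> : 'X%:M = map_mx polyC (invmx P) *m 'X%:M *m map_mx polyC P.
    by rewrite scalar_mxC -mulmxA -map_mxM mulVmx // map_mx1 mulmx1.
  rewrite -mulmxBl -mulmxBr !det_mulmx mulrAC -det_mulmx -map_mxM mulVmx //.
  rewrite map_mx1 det1 mul1r map_diag_mx.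
  transitivity (\det (diag_mx (\row_i ('X - (d 0 i)%:P)))).
    congr (\det _); apply/matrixP => i j; rewrite !mxE.
    by case: eqP => [->|_]; rewrite ?mulr1n ?mulr0n ?subr0.
  by rewrite det_diag; apply: eq_bigr => i _; rewrite mxE.
pose s := [seq complex.Re (d 0 i) | i <- enum 'I_p].
exists (sort >=%R s); split; first by apply: sort_sorted => x y; exact: le_total.
rewrite (perm_big s) /=; last by rewrite perm_sort.
apply: (map_poly_inj toC); rewrite map_char_poly -/AC charE rmorph_prod.
rewrite big_map big_enum /=; apply: eq_bigr => i _.
by rewrite rmorphB /= map_polyX map_polyC /= [in LHS]d_real.
Qed.

Section Objective.
Context {R : realType} {p : nat}.
Implicit Types (S : 'M[R]_p) (phi : 'rV[R]_p) (r : nat) (eps : R).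

Definition scaled_mx S phi : 'M[R]_p :=
  diag_mx (map_mx Num.sqrt phi) *m S *m diag_mx (map_mx Num.sqrt phi).

(* 0-based: [lambda_star S phi i] is the (i+1)-th largest eigenvalue. *)
Definition lambda_star S phi (i : nat) : R :=
  nth 0 (eigenvalues (scaled_mx S phi)) i.

Definition f1 S phi : R := \sum_(i < p) (- ln (phi 0 i) + S i i * phi 0 i).

Definition f2 S r phi : R :=
  - \sum_(i < r) (ln (Num.max 1 (lambda_star S phi i))
                  - Num.max 1 (lambda_star S phi i) + 1).

Definition fobj S r phi : R := f1 S phi - f2 S r phi.

Definition Cset eps : set 'rV[R]_p :=
  [set phi | forall i, 0 < phi 0 i <= eps^-1].

(* Indexed from 1, so [phi 0] and [nabla 0] are irrelevant. *)
Definition dc_sequence S r eps (phi nabla : nat -> 'rV[R]_p) : Prop :=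
  Cset eps (phi 1%N) /\
  forall k, (1 <= k)%N ->
    is_subgradient (orthant R p) (f2 S r) (phi k) (nabla k) /\
    is_argmin (Cset eps)
      (fun psi => \sum_(i < p)
         (- ln (psi 0 i) + S i i * psi 0 i - nabla k 0 i * psi 0 i))
      (phi k.+1).

End Objective.

(* Main.v *)
(* The subgradient inequality for f2 gives
     f(phi_k) - f(phi_{k+1}) >= f1(phi_k) - f1(phi_{k+1}) - <nabla_k, phi_k - phi_{k+1}>.
   Strong convexity of f1 at phi_{k+1} and the first-order optimality condition
   <grad f1(phi_{k+1}) - nabla_k, phi_k - phi_{k+1}> >= 0 bound this below by
   rho/2 |phi_{k+1} - phi_k|^2; convexity of f2 is not otherwise involved.  On C the
   eigenvalues of Phi^{1/2} S Phi^{1/2} are bounded by sum_ij |s_ij| / eps, so f is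
   bounded below; the rate follows by telescoping. *)
Require Import Defs.
From HB Require Import structures.
From mathcomp Require Import all_boot all_order all_algebra.
From mathcomp Require Import all_classical all_reals all_analysis ring lra.

Set Implicit Arguments.
Unset Strict Implicit.
Unset Printing Implicit Defensive.

Import Order.TTheory GRing.Theory Num.Theory.
Import numFieldNormedType.Exports.

Local Open Scope classical_set_scope.
Local Open Scope ring_scope.

Section ScalarLog.
Context {R : realType}.
Implicit Types b c e t u x y : R.

Lemma ln_le_subr1 u : 0 < u -> ln u <= u - 1.
Proof. by move=> u_gt0; rewrite -[X in ln X](subrKC 1) le_ln1Dx //; lra. Qed.

(** The second derivative [1/t^2] of [- ln t] is at least [e^2] on [(0, 1/e]], hence the modulus.
    Summed over the coordinates, this gives the strong convexity of [f1]. *)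
Lemma ln_strongly_concave e x y :
  0 < e -> 0 < x <= e^-1 -> 0 < y <= e^-1 ->
  e ^+ 2 / 2 * (x - y) ^+ 2 <= (x - y) / y - (ln x - ln y).
Proof.
move=> e_gt0 /andP[x_gt0 xe] /andP[y_gt0 ye].
(* MVT on [h]: for [t] in (0, 1/e], [h' t] = (t - y)(1/(ty) - e^2) has the sign of [t - y]. *)
pose h t := (t - y) / y - ln t - e ^+ 2 / 2 * (t - y) ^+ 2.
pose dh t := (t - y) * ((t * y)^-1 - e ^+ 2).
have dhP t : 0 < t -> is_derive t 1 h (dh t).
  move=> t_gt0; have ln_drv := is_derive1_ln t_gt0.
  rewrite /h; apply: is_derive_eq.
  rewrite /dh /GRing.scale /=; field.
  by rewrite !gt_eqF.
have factor_ge0 t : 0 < t -> t <= e^-1 -> 0 <= (t * y)^-1 - e ^+ 2.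
  move=> t_gt0 te; rewrite subr_ge0 -[e ^+ 2]invrK lef_pV2 ?posrE ?mulr_gt0 ?invr_gt0
    ?exprn_gt0//.
  by rewrite -exprVn expr2 ler_pM // ltW.
suff : h y <= h x by rewrite /h subrr !mul0r expr0n mulr0 /=; lra.
have contP a b : 0 < a -> {within `[a, b], continuous h}.
  move=> a_gt0; apply: derivable_within_continuous => t; rewrite in_itv /= => /andP[at_ _].
  by have [] := dhP _ (lt_le_trans a_gt0 at_).
have [yx|/ltW xy] := leP y x.
- have [|c] := @MVT_segment R h dh y x yx _ (contP _ _ y_gt0).
    by move=> t; rewrite in_itv /= => /andP[yt _]; apply/dhP/(lt_trans y_gt0).
  rewrite in_itv /= => /andP[yc cx] hE; rewrite -subr_ge0 hE.
  apply: mulr_ge0; last by rewrite subr_ge0.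
  apply: mulr_ge0; first by rewrite subr_ge0.
  exact: factor_ge0 (lt_le_trans y_gt0 yc) (le_trans cx xe).
- have [|c] := @MVT_segment R h dh x y xy _ (contP _ _ x_gt0).
    by move=> t; rewrite in_itv /= => /andP[xt _]; apply/dhP/(lt_trans x_gt0).
  rewrite in_itv /= => /andP[xc cy] hE; rewrite -subr_le0 hE.
  apply: mulr_le0_ge0; last by rewrite subr_ge0.
  apply: mulr_le0_ge0; first by rewrite subr_le0.
  exact: factor_ge0 (lt_le_trans x_gt0 xc) (le_trans cy ye).
Qed.

(** First-order optimality for [- ln u + c * u], whose derivative at [y] is [c - y^-1]. It is an
    inequality because the minimiser [y] may be the endpoint [b]. *)
Lemma ln_argmin_variation b c y :
  0 < y <= b -> (forall u, 0 < u <= b -> - ln y + c * y <= - ln u + c * u) ->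
  forall u, 0 < u <= b -> 0 <= (c - y^-1) * (u - y).
Proof.
move=> /andP[y_gt0 yb] ymin u /andP[u_gt0 ub].
pose d := u - y; pose A := d * (c * y - 1).
have AE : (c - y^-1) * (u - y) = A / y by rewrite /A /d; field; rewrite gt_eqF.
rewrite AE divr_ge0 ?(ltW y_gt0) // leNgt; apply/negP => A_lt0.
(* Minimality at [y + t d], after linearising [ln] and multiplying by [(y + t d) / t]. *)
have step t : 0 < t <= 1 -> 0 <= A + t * (c * d ^+ 2).
  move=> /andP[t_gt0 t1]; pose z := y + t * d.
  have zE : z = (1 - t) * y + t * u by rewrite /z /d; ring.
  have z_gt0 : 0 < z by rewrite zE ltr_wpDl // ?mulr_gt0 // mulr_ge0 ?subr_ge0 // ltW.
  have zb : z <= b.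
    have -> : b = (1 - t) * b + t * b by ring.
    by rewrite zE lerD // ler_wpM2l ?subr_ge0 // ltW.
  have := ymin z; rewrite z_gt0 zb => /(_ isT) zmin.
  have := ln_le_subr1 (divr_gt0 y_gt0 z_gt0); rewrite ln_div ?posrE // => lnz.
  have : 0 <= t / z * (A + t * (c * d ^+ 2)).
    have -> : t / z * (A + t * (c * d ^+ 2)) = c * z - c * y + y / z - 1.
      by rewrite /A /z; field; rewrite -/z gt_eqF.
    lra.
  by rewrite pmulr_rge0 // divr_gt0.
have B_gt0 : 0 < c * d ^+ 2 by have := step 1; rewrite ltr01 lexx => /(_ isT); lra.
(* This [t] turns the bound of [step] into [0 <= A / 2], contradicting [A < 0]. It is at most 1
   because [step 1] gives [- A <= c * d ^+ 2]. *)
pose t := - A / (2 * (c * d ^+ 2)).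
have tE : t * (c * d ^+ 2) = - A / 2.
  by rewrite /t; move: (c * _) B_gt0 => B B_gt0; field; rewrite gt_eqF.
have B2_gt0 : 0 < 2 * (c * d ^+ 2) by rewrite mulr_gt0.
have t_gt0 : 0 < t by rewrite /t divr_gt0 ?oppr_gt0.
have t_le1 : t <= 1.
  rewrite ler_pdivrMr ?B2_gt0 //.
  by have := step 1; rewrite ltr01 lexx => /(_ isT); lra.
by have := step t; rewrite t_gt0 t_le1 tE => /(_ isT); lra.
Qed.

End ScalarLog.

Lemma gradient_f1 (R : realType) (p : nat) (S : 'M[R]_p) (phi : 'rV[R]_p) (i : 'I_p) :
  0 < phi 0 i -> gradient (f1 S) phi 0 i = S i i - (phi 0 i)^-1.
Proof.
move=> phi_gt0; rewrite mxE.
pose g (t : R) := - ln t + S i i * t.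
have g_drv : is_derive (phi 0 i) 1 g (S i i - (phi 0 i)^-1).
  have ln_drv := is_derive1_ln phi_gt0.
  by rewrite /g; apply: is_derive_eq; rewrite /GRing.scale /=; ring.
(* Along the [i]-th basis vector only the [i]-th summand varies, so the difference quotients of
   [f1 S] are those of the scalar function [g]. *)
suff shiftE t : (f1 S \o shift phi) (t *: delta_mx 0 i) - f1 S phi =
    (g \o shift (phi 0 i)) (t *: 1) - g (phi 0 i).
  rewrite -[RHS](@derive_val _ _ _ _ _ _ _ g_drv) /derive.
  by under eq_fun do rewrite shiftE.
have f1E psi : f1 S psi =
    g (psi 0 i) + \sum_(j < p | j != i) (- ln (psi 0 j) + S j j * psi 0 j).
  by rewrite /f1 (bigD1 i).
rewrite /= !f1E opprD addrACA.
rewrite !mxE !eqxx mulr1 scaler1 -[RHS]addr0; congr (_ + _).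
apply/eqP; rewrite subr_eq0; apply/eqP; apply: eq_bigr => j ji.
by rewrite !mxE (negbTE ji) andbF mulr0 add0r.
Qed.

(** Take a left eigenvector [v] and compare the two sides of [v *m A = a *: v] at a coordinate where
    [v] is largest in absolute value. *)
Lemma eigenvalue_le_sum_norm (R : realFieldType) (p : nat) (A : 'M[R]_p) (a : R) :
  eigenvalue A a -> `|a| <= \sum_i \sum_j `|A i j|.
Proof.
case/eigenvalueP => v vA v_neq0.
have [k vk_neq0] : exists k, v 0 k != 0 by apply/rV0Pn.
have [j _ jmax] := @arg_maxP _ _ _ k predT (fun j => `|v 0 j|) isT.
have vj_gt0 : 0 < `|v 0 j| by apply: lt_le_trans (jmax k isT); rewrite normr_gt0.
rewrite -(ler_pM2r vj_gt0) -normrM.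
have -> : a * v 0 j = \sum_i v 0 i * A i j by move/matrixP/(_ 0 j): vA; rewrite !mxE.
apply: le_trans (ler_norm_sum _ _ _) _; rewrite mulr_suml ler_sum // => i _.
rewrite normrM mulrC ler_pM //; last exact: jmax.
by rewrite (bigD1 j) //= lerDl sumr_ge0.
Qed.

(** On [Cset eps] each factor [Num.sqrt (phi 0 k)] is at most the root of [eps^-1], so scaling
    multiplies each entry of [S] by at most [eps^-1] in absolute value. *)
Lemma lambda_star_le (R : realType) (p : nat) (S : 'M[R]_p) (eps : R)
    (phi : 'rV[R]_p) (i : nat) :
  0 < eps -> S^T = S -> Cset eps phi ->
  lambda_star S phi i <= eps^-1 * \sum_i \sum_j `|S i j|.
Proof.
move=> eps_gt0 S_sym phiC.
have bound_ge0 : 0 <= eps^-1 * \sum_i \sum_j `|S i j|.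
  by rewrite mulr_ge0 ?invr_ge0 ?(ltW eps_gt0) // sumr_ge0 // => k _; rewrite sumr_ge0.
rewrite /lambda_star; set A := scaled_mx S phi.
have A_sym : A^T = A by rewrite /A /scaled_mx !trmx_mul !tr_diag_mx S_sym mulmxA.
have [_ charE] := eigenvalues_sym A_sym.
(* Past the end of the spectrum [nth] returns 0, which [bound_ge0] covers. *)
have [i_lt|i_ge] := ltnP i (size (eigenvalues A)); last by rewrite nth_default.
apply: le_trans (ler_norm _) (le_trans (eigenvalue_le_sum_norm (A := A) _) _).
  by rewrite eigenvalue_root_char charE root_prod_XsubC mem_nth.
rewrite mulr_sumr ler_sum // => k _; rewrite mulr_sumr ler_sum // => l _.
have sqrt_le m : Num.sqrt (phi 0 m) <= Num.sqrt eps^-1.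
  by have /andP[_ phi_le] := phiC m; exact: ler_wsqrtr.
rewrite /A /scaled_mx mul_mx_diag mul_diag_mx !mxE !normrM mulrAC.
rewrite ler_wpM2r // !ger0_norm ?sqrtr_ge0 //.
by rewrite -[eps^-1]sqr_sqrtr ?invr_ge0 ?(ltW eps_gt0) // expr2 ler_pM ?sqrtr_ge0.
Qed.

Lemma f1_strongly_convex (R : realType) (p : nat) (S : 'M[R]_p) (eps : R) :
  0 < eps -> strongly_convex_with (Cset eps) (f1 S) (eps ^+ 2).
Proof.
move=> eps_gt0 x y xC yC; rewrite /norm2 sqr_sqrtr; last first.
  by rewrite sumr_ge0 // => i _; rewrite sqr_ge0.
rewrite /f1 /dotv mulr_sumr -!big_split /= ler_sum // => i _.
have /andP[yi_gt0 _] := yC i; rewrite gradient_f1 // !mxE.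
have := ln_strongly_concave eps_gt0 (xC i) (yC i); lra.
Qed.

Lemma dc_step_variation (R : realType) (p : nat) (S : 'M[R]_p) (eps : R)
    (g x y : 'rV[R]_p) :
  is_argmin (Cset eps) (fun psi => \sum_(i < p)
    (- ln (psi 0 i) + S i i * psi 0 i - g 0 i * psi 0 i)) y ->
  Cset eps x -> dotv g (x - y) <= dotv (gradient (f1 S) y) (x - y).
Proof.
case=> yC ymin xC; apply: ler_sum => i _.
have /andP[yi_gt0 _] := yC i; rewrite gradient_f1 // !mxE -subr_ge0 -mulrBl addrAC.
apply: (ln_argmin_variation (yC i) _ (xC i)) => u u_bounds.
(* The objective is separable and [Cset eps] is a box, so changing one coordinate shows that [y 0 i]
   minimises the [i]-th summand, with slope [c = S i i - g 0 i]. *)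
pose z : 'rV[R]_p := \row_j (if j == i then u else y 0 j).
have zC : Cset eps z by move=> j; rewrite mxE; case: ifP.
have := ymin z zC; rewrite (bigD1 i) //= [leRHS](bigD1 i) //= mxE eqxx.
rewrite (eq_bigr (fun j => - ln (z 0 j) + S j j * z 0 j - g 0 j * z 0 j)); last first.
  by move=> j ji; rewrite !mxE (negbTE ji).
by rewrite lerD2r; lra.
Qed.

(** Each summand of [f1] is at least [1 + ln (S i i)], by [ln v <= v - 1] at [v = S i i * phi 0 i].
    Each summand of [- f2] is at least [1 - L], its logarithm being nonnegative. *)
Lemma fobj_lower_bound (R : realType) (p r : nat) (S : 'M[R]_p) (eps : R) :
  0 < eps -> S^T = S -> (forall i, 0 < S i i) ->
  exists m, forall phi, Cset eps phi -> m <= fobj S r phi.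
Proof.
move=> eps_gt0 S_sym S_diag.
pose L := Num.max 1 (eps^-1 * \sum_i \sum_j `|S i j|).
exists (\sum_(i < p) (1 + ln (S i i)) + \sum_(i < r) (1 - L)) => phi phiC.
rewrite /fobj /f2 opprK lerD // ler_sum // => i _.
- have /andP[phi_gt0 _] := phiC i.
  have := ln_le_subr1 (mulr_gt0 (S_diag i) phi_gt0).
  by rewrite lnM ?posrE //; lra.
- have : Num.max 1 (lambda_star S phi i) <= L.
    by rewrite ge_max !le_max lexx /= lambda_star_le ?orbT.
  have := @ln_ge0 R (Num.max 1 (lambda_star S phi i)).
  by rewrite le_max lexx => /(_ isT); lra.
Qed.

Lemma dc_sequence_Cset (R : realType) (p r : nat) (S : 'M[R]_p) (eps : R)
    (phi nabla : nat -> 'rV[R]_p) (k : nat) :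
  dc_sequence S r eps phi nabla -> (1 <= k)%N -> Cset eps (phi k).
Proof.
case=> phi1C phi_step; case: k => [//|[//|k] _].
by have [_ []] := phi_step k.+1 isT.
Qed.

Lemma fobj_descent (R : realType) (p r : nat) (S : 'M[R]_p) (eps rho : R)
    (phi nabla : nat -> 'rV[R]_p) (k : nat) :
  dc_sequence S r eps phi nabla ->
  strongly_convex_with (Cset eps) (f1 S) rho -> (1 <= k)%N ->
  rho / 2 * norm2 (phi k.+1 - phi k) ^+ 2 <= fobj S r (phi k) - fobj S r (phi k.+1).
Proof.
move=> phi_dc f1_sc k_ge1; have [nabla_sub phi_argmin] := phi_dc.2 k k_ge1.
have kC := dc_sequence_Cset phi_dc k_ge1.
have SkC : Cset eps (phi k.+1) by exact: dc_sequence_Cset phi_dc _.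
have orthSk : orthant R p (phi k.+1) by move=> i; have /andP[] := SkC i.
have norm2C : norm2 (phi k - phi k.+1) = norm2 (phi k.+1 - phi k).
  by congr Num.sqrt; apply: eq_bigr => i _; rewrite !mxE -sqrrN opprB.
have dotvN : dotv (nabla k) (phi k - phi k.+1) = - dotv (nabla k) (phi k.+1 - phi k).
  by rewrite -sumrN; apply: eq_bigr => i _; rewrite -mulrN !mxE opprB.
(* When the three inequalities are added, the inner products with [nabla k] and with the gradient
   cancel. *)
have := f1_sc _ _ kC SkC; have := dc_step_variation phi_argmin kC.
have := nabla_sub _ orthSk; rewrite norm2C dotvN /fobj.
move: (f1 S _) (f1 S _) (f2 S r _) (f2 S r _) (dotv _ _) (dotv _ _) (norm2 _ ^+ 2).
by clear=> *; lra.
Qed.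

Theorem proposition8 (R : realType) (p r : nat) (S : 'M[R]_p) (eps rho : R)
    (phi nabla : nat -> 'rV[R]_p)
    (p_ge1 : (1 <= p)%N) (r_bounds : (1 <= r <= p)%N) (eps_gt0 : 0 < eps)
    (S_psd : psdmx S) (S_diag : forall i, 0 < S i i)
    (phi_dc : dc_sequence S r eps phi nabla)
    (rho_coeff : is_strong_convexity_coeff (Cset eps) (f1 S) rho) :
  eps ^+ 2 <= rho /\
  (forall k, (1 <= k)%N -> fobj S r (phi k.+1) <= fobj S r (phi k)) /\
  exists fhat : R,
    (fun k => fobj S r (phi k)) @ \oo --> fhat /\
    forall K : nat, (1 <= K)%N ->
      \big[Num.min/rho * norm2 (phi 2%N - phi 1%N) ^+ 2]_(1 <= k < K.+1)
         (rho * norm2 (phi k.+1 - phi k) ^+ 2)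
      <= 2 / K%:R * (fobj S r (phi 1%N) - fhat).
Proof.
have [f1_sc rho_max] := rho_coeff.
have rho_ge : eps ^+ 2 <= rho by apply/rho_max/f1_strongly_convex.
have rho_ge0 : 0 <= rho by apply: le_trans rho_ge; rewrite sqr_ge0.
have descent k := @fobj_descent _ _ _ _ _ _ _ _ k phi_dc f1_sc.
pose f k := fobj S r (phi k).
have f_noninc k : (1 <= k)%N -> f k.+1 <= f k.
  move=> /descent step; rewrite -subr_ge0; apply: le_trans step.
  by rewrite mulr_ge0 ?divr_ge0 ?sqr_ge0.
split=> //; split=> //.
have [m m_le] := fobj_lower_bound r eps_gt0 S_psd.1 S_diag.
(* The shift drops the arbitrary [phi 0]: monotonicity and the lower bound hold only from index
   1. *)
pose u k := f k.+1.
have u_noninc : nonincreasing_seq u by apply/nonincreasing_seqP => k; exact: f_noninc.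
have u_cvg : cvgn u.
  apply: nonincreasing_is_cvgn => //; exists m => _ [k _ <-].
  by apply/m_le/(dc_sequence_Cset phi_dc).
exists (limn u); split; first by rewrite -cvg_shiftS; exact: u_cvg.
(* The default value of the minimum is its term at [k = 1], which lies in the range since [1 <= K];
   so [mu] is the true minimum. *)
move=> K K_ge1; set mu := \big[_/_]_(_ <= _ < _) _.
have mu_le k : (k < K)%N -> mu <= 2 * (u k - u k.+1).
  move=> kK; apply: (@le_trans _ _ (rho * norm2 (phi k.+2 - phi k.+1) ^+ 2)).
    by apply: ge_bigmin_seq => //; rewrite mem_index_iota /= !ltnS.
  by have := descent k.+1 isT; rewrite mulrAC ler_pdivrMr // [leRHS]mulrC.
(* Sum [mu_le] over [k < K]: the left side is [K] copies of [mu], the right side telescopes. *)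
have sum_le : mu * K%:R <= 2 * (u 0%N - u K).
  rewrite -[u 0%N - u K]opprB -(telescope_sumr u) // -sumrN mulr_sumr big_mkord.
  rewrite mulr_natr -[X in _ *+ X]card_ord -sumr_const.
  by apply: ler_sum => k _; rewrite opprB mu_le.
rewrite mulrAC ler_pdivlMr ?ltr0n //; apply: le_trans sum_le _.
by rewrite ler_pM2l // lerD2l lerN2 nonincreasing_cvgn_ge.
Qed.
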